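(* Let $\varepsilon>0$, let $r>1$, and let $(a_n)_{n\in\mathbb{N}}$ be an increasing sequence of positive integers which is lacunary with growth factor $r$. Let $\mu\in\mathcal{M}([0,1])$ and assume that there exist $\Upsilon>0$ and $C>0$ such that $|(\mathcal{F}\mu)(x)|\le C(1+|x|)^{-\Upsilon}$ for all $x\in\mathbb{R}$. Then for $\mu$-almost all $\alpha\in[0,1]$ there exists $N_0(\alpha)\in\mathbb{N}$ such that $$G(\{\alpha a_n\}_{n\le N})\le\frac{(\log N)^{2+\varepsilon}}{N}$$ for all $N\in\mathbb{N}$ with $N\ge N_0(\alpha)$.
   Context: A sequence $(a_n)_{n\in\mathbb{N}}$ is lacunary with growth factor $r>1$ if $a_{n+1}\ge r a_n$ for every $n\in\mathbb{N}$. $\mathcal{M}([0,1])$ denotes the set of (finite, positive) Borel measures supported on a compact subset of $[0,1]$. The Fourier transform of $\mu\in\mathcal{M}([0,1])$ is $(\mathcal{F}\mu)(x):=\int_0^1 e^{-2\pi i\xi x}\,d\mu(\xi)$. Maximal gap: for a finite family of real numbers $z_1,\dots,z_m$ ($m\ge1$), reduce each $z_i$ modulo $1$ to a representative in $[0,1)$ and sort these representatives as $0\le y_1\le y_2\le\dots\le y_m<1$; put $y_{m+1}:=1+y_1$. Then $G(\{z_i\}_{i\le m}):=\max_{2\le k\le m+1}(y_k-y_{k-1})$ is the largest gap between neighbouring points on the unit torus. Thus $G(\{\alpha a_n\}_{n\le N})$ is the maximal gap of the points $\alpha a_1,\dots,\alpha a_N$ modulo $1$. *)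

(* Defs.v *)
From mathcomp Require Import all_boot all_order all_algebra.
From mathcomp Require Import complex.
From mathcomp Require Import all_classical all_reals all_analysis.

Set Implicit Arguments.
Unset Strict Implicit.
Unset Printing Implicit Defensive.

Import Order.TTheory GRing.Theory Num.Theory.
Import numFieldNormedType.Exports.

Local Open Scope classical_set_scope.
Local Open Scope ring_scope.

(* Sequences are indexed by the positive integers: the value at 0 is never
   constrained nor used. *)
Definition increasing_seq1 (a : nat -> nat) : Prop :=
  forall n : nat, (0 < n)%N -> (a n < a n.+1)%N.

Definition positive_seq1 (a : nat -> nat) : Prop :=
  forall n : nat, (0 < n)%N -> (0 < a n)%N.

Definition lacunary1 (R : realType) (r : R) (a : nat -> R) : Prop :=
  forall n : nat, (0 < n)%N -> r * a n <= a n.+1.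

Definition supported_in_01 (R : realType)
    (mu : {finite_measure set (measurableTypeR R) -> \bar R}) : Prop :=
  exists K : set R, [/\ compact K, K `<=` `[0, 1] & mu (~` K) = 0%E].

Definition expi (R : realType) (t : R) : R[i] := (cos t +i* sin t)%C.

(* `Rintegral` is real-valued; a complex integrand is integrated
   componentwise. *)
Definition Cintegral (d : measure_display) (T : measurableType d) (R : realType)
    (mu : {measure set T -> \bar R}) (D : set T) (f : T -> R[i]) : R[i] :=
  (Rintegral mu D (fun t => complex.Re (f t)) +i*
   Rintegral mu D (fun t => complex.Im (f t)))%C.

Definition fourier (R : realType)
    (mu : {finite_measure set (measurableTypeR R) -> \bar R}) (x : R) : R[i] :=
  Cintegral mu `[0, 1] (fun xi : R => expi (- (2 * pi * xi * x))).

Definition frac_part (R : realType) (z : R) : R := z - (Num.floor z)%:~R.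

(* The points y_1 <= ... <= y_m, y_(m+1) := 1 + y_1 of a family z_1, ..., z_m
   (listed from index 0). *)
Definition torus_points (R : realType) (z : seq R) : seq R :=
  let y := sort <=%R [seq frac_part t | t <- z] in rcons y (1 + head 0 y).

(* For a nonempty family the default value 0 of the maximum is harmless, since
   consecutive differences of `torus_points z` are nonnegative. *)
Definition max_gap (R : realType) (z : seq R) : R :=
  \big[Num.max/0]_(0 <= k < size z)
    ((torus_points z)`_k.+1 - (torus_points z)`_k).

(* Main.v *)
(* Normalise the Fejer kernel so that its D translates by multiples of 1/D sum
   to 1.  Summing consecutive translates gives a
   trigonometric polynomial f of degree < D with 0 <= f <= 1 which is tiny off
   an interval of length delta and has mean of order delta; adding a small
   constant to 1 - f gives a nonnegative g which is at least 1 off the interval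
   and has mean c0 <= 1 - delta/8.  If no point alpha * b_i, i <= M, falls in
   the interval then prod_i g (b_i alpha) >= 1, so by Markov's inequality it
   suffices to bound the mu-integral of this Riesz product.

   Along b_i = a_(1+iK), with K of order log N, consecutive ratios exceed a large
   power of N.  Hence every frequency of the expanded product is governed by its
   top index i, and the Fourier decay beats the sum of the coefficients: the
   integral is at most c0^M times a constant.  With D = N^3,
   delta = (log N)^(2+eps)/N and M of order N/log N, c0^M is at most
   exp(- c (log N)^(1+eps)), which survives a union bound over the O(D) possible
   positions of the interval, and Borel-Cantelli applies. *)

Require Import Defs.
From mathcomp Require Import all_boot all_order all_algebra.
From mathcomp Require Import complex.
From mathcomp Require Import all_classical all_reals all_analysis.
From mathcomp Require Import measurable_realfun.
From mathcomp Require Import ring lra.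

Import Order.TTheory GRing.Theory Num.Theory.
Import numFieldNormedType.Exports.

Local Open Scope classical_set_scope.
Local Open Scope ring_scope.

(** * The Fejer kernel *)

Section Trig.
Context {R : realType}.
Implicit Types (t u y : R).

(** The product-to-sum formula makes the sum telescope. This closed form serves both the decay of
    the Fejer kernel and the vanishing of its off-diagonal sums. *)
Lemma sin_mul_sum_cos n t u :
  2 * sin u * \sum_(k < n) cos (t + k%:R * (2 * u)) =
  sin (t + n%:R * (2 * u) - u) - sin (t - u).
Proof.
elim: n => [|n IH]; first by rewrite big_ord0 mulr0 mul0r addr0 subrr.
rewrite big_ord_recr /= mulrDr IH.
set v := t + n%:R * (2 * u).
have -> : t + n.+1%:R * (2 * u) - u = v + u by rewrite /v -natr1; ring.
rewrite (sinD v u) (sinB v u); ring.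
Qed.

Lemma sinD2pi_nat t n : sin (t + 2 * pi * n%:R) = sin t.
Proof.
rewrite -(periodicn (@sinD2pi R) n t); congr sin; congr (_ + _).
by rewrite -[RHS]mulr_natr -[pi *+ 2]mulr_natl.
Qed.

Lemma sinDpi_sqr_int t (n : int) : sin (t + pi * n%:~R) ^+ 2 = sin t ^+ 2.
Proof.
have H (s : R) (m : nat) : sin (s + pi * m%:R) ^+ 2 = sin s ^+ 2.
  by rewrite mulr_natr alternatingn ?exprMn ?sqrr_sign ?mul1r //; exact: sinDpi.
case: n => m; first exact: H.
rewrite NegzE rmorphN /= mulrN -[in RHS](subrK (pi * m.+1%:R) t).
by rewrite H.
Qed.

Lemma cos_piquarter_ge : 1 / 2 <= cos (pi / 4 : R).
Proof.
have pi0 := @pi_gt0 R.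
have c0 : 0 <= cos (pi / 4 : R).
  by apply: cos_ge0_pihalf; apply/andP; split; lra.
have : cos (pi / 4 : R) ^+ 2 = 1 / 2.
  have := cos_mulr2n (pi / 4 : R).
  have -> : pi / 4 *+ 2 = pi / 2 :> R by rewrite -mulr_natr; field.
  rewrite cos_pihalf -mulr_natr => h; lra.
move=> h; nra.
Qed.

(** Up to 1/4 the mean value theorem applies, with derivative at least [cos (pi / 4)], hence at
    least 1/2, and [pi] at least 2. Beyond 1/4, monotonicity gives a sine of at least 1/2. *)
Lemma le_sin_pi u : 0 <= u <= 1 / 2 -> u <= sin (pi * u).
Proof.
have pi2 := @pi_ge2 R; have c4 := cos_piquarter_ge.
move=> /andP[u0 u2]; case: (lerP u (1 / 4)) => u4.
- have [->|un0] := eqVneq u 0; first by rewrite mulr0 sin0.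
  have up : 0 < u by rewrite lt_neqAle eq_sym un0.
  have pu : 0 < pi * u by nra.
  have [|c] := @MVT _ sin cos 0 (pi * u) pu (fun x _ => is_derive_sin x).
    by apply: continuous_subspaceT => x; exact: continuous_sin.
  rewrite in_itv /= => /andP[c0 c1].
  rewrite sin0 !subr0 => ->.
  have : cos (pi / 4 : R) <= cos c.
    rewrite leNgt; apply/negP; rewrite ltr_cos ?in_itv /=; first by nra.
    - by apply/andP; split; nra.
    - by apply/andP; split; nra.
  by nra.
- have s4 : sin (pi / 4 : R) = cos (pi / 4).
    by rewrite -cosBpihalf -cosN; congr cos; field.
  have : sin (pi / 4 : R) <= sin (pi * u).
    rewrite leNgt; apply/negP; rewrite ltr_sin ?in_itv /=; first by nra.
    - by apply/andP; split; nra.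
    - by apply/andP; split; nra.
  by lra.
Qed.

(** The squared sine is even and invariant under integer shifts of [y], so [y] may be replaced by
    its distance to the nearest integer. *)
Lemma sin_pi_sqr_ge (d y : R) : 0 <= d ->
  (forall n : int, d <= `|y + n%:~R|) -> d ^+ 2 <= sin (pi * y) ^+ 2.
Proof.
move=> d0 h.
pose n := Num.floor (y + 1 / 2).
have /andP[n1 n2] := Num.Theory.floor_itv (y + 1 / 2).
rewrite -/n intrD in n1 n2.
have {}h := h (- n); rewrite rmorphN /= in h.
set z := y - n%:~R in h.
rewrite -(sinDpi_sqr_int _ (- n)) -mulrDr rmorphN /= -/z.
have : `|z| <= sin (pi * `|z|).
  apply: le_sin_pi; rewrite normr_ge0 /= ler_norml; apply/andP; split; rewrite /z; lra.
move=> h1.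
have -> : sin (pi * z) ^+ 2 = sin (pi * `|z|) ^+ 2.
  case: (ger0P z) => _ //; by rewrite mulrN sinN sqrrN.
have := normr_ge0 z; nra.
Qed.

(** The squared modulus of the sum of exp(2 pi i j y) over j < D, kept real by separating cosines
    and sines. Dividing by D^2 rather than D gives mean 1/D. *)
Definition fejer (D : nat) (y : R) : R :=
  ((\sum_(j < D) cos (2 * pi * j%:R * y)) ^+ 2 +
   (\sum_(j < D) sin (2 * pi * j%:R * y)) ^+ 2) / D%:R ^+ 2.

Lemma fejerE D y : fejer D y =
  (\sum_(j < D) \sum_(l < D) cos (2 * pi * (j%:R - l%:R) * y)) / D%:R ^+ 2.
Proof.
rewrite /fejer; congr (_ / _).
rewrite !expr2 !mulr_suml -big_split; apply: eq_bigr => j _ /=.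
rewrite !mulr_sumr -big_split; apply: eq_bigr => l _ /=.
by rewrite -cosB; congr cos; ring.
Qed.

Lemma fejer_ge0 D y : 0 <= fejer D y.
Proof. by rewrite divr_ge0 ?addr_ge0 ?sqr_ge0. Qed.

Lemma fejer_le D d y : 0 < d ->
  (forall n : int, d <= `|y + n%:~R|) -> fejer D y <= 2 / (D%:R * d) ^+ 2.
Proof.
move=> d0 /(sin_pi_sqr_ge _ _ (ltW d0)) sd.
have [->|D0] := posnP D.
  by rewrite /fejer !big_ord0 mul0r !expr0n /= addr0 mul0r invr0 mulr0.
have s0 : 0 < sin (pi * y) ^+ 2 by rewrite (lt_le_trans _ sd)// exprn_gt0.
(* The phase [t] is free so that [t = 0] yields the cosine sum and [t = - (pi / 2)] the sine sum. *)
have B t : (\sum_(j < D) cos (t + j%:R * (2 * (pi * y)))) ^+ 2 <=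
    1 / sin (pi * y) ^+ 2.
  rewrite ler_pdivlMr // -exprMn.
  have := sin_mul_sum_cos D t (pi * y).
  set S := \sum_(_ < _) _.
  set p := t + _ - _; set q := t - _.
  have := sin_le1 p; have := sin_geN1 p; have := sin_le1 q; have := sin_geN1 q.
  set s := sin (pi * y) => h1 h2 h3 h4 h5.
  have : -1 <= S * s <= 1 by apply/andP; split; lra.
  move=> /andP[]; nra.
have DR : 0 < D%:R :> R by rewrite ltr0n.
rewrite /fejer.
have -> : 2 / (D%:R * d) ^+ 2 = 2 / d ^+ 2 / D%:R ^+ 2.
  by field; rewrite !gt_eqF.
rewrite ler_wpM2r ?invr_ge0 ?sqr_ge0 //.
have d2 : 0 < d ^+ 2 by rewrite exprn_gt0.
apply: (@le_trans _ _ (2 / sin (pi * y) ^+ 2)); last first.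
  by rewrite ler_wpM2l // lef_pV2.
have -> : 2 / sin (pi * y) ^+ 2 =
  1 / sin (pi * y) ^+ 2 + 1 / sin (pi * y) ^+ 2 by ring.
apply: lerD.
- apply: le_trans (B 0); rewrite le_eqVlt; apply/orP; left; apply/eqP.
  by congr (_ ^+ 2); apply: eq_bigr => j _; congr cos; ring.
- apply: le_trans (B (- (pi / 2))); rewrite le_eqVlt; apply/orP; left; apply/eqP.
  congr (_ ^+ 2); apply: eq_bigr => j _.
  by rewrite -[RHS]cosN -[LHS]cosBpihalf -[LHS]cosN; congr cos; ring.
Qed.

(** The angles make [h] full turns, so the telescoped difference of sines is zero, whereas the
    prefactor sin(pi h / D) is not. *)
Lemma sum_cos_roots (D h : nat) t : (0 < h < D)%N ->
  \sum_(k < D) cos (t + k%:R * (2 * (pi * (h%:R / D%:R)))) = 0.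
Proof.
move=> /andP[h0 hD].
have D0 : 0 < D%:R :> R by rewrite ltr0n (ltn_trans h0).
have := sin_mul_sum_cos D t (pi * (h%:R / D%:R)).
set p := t + _ - _; set q := t - _.
have -> : p = q + 2 * pi * h%:R by rewrite /p /q; field; rewrite gt_eqF.
rewrite sinD2pi_nat subrr => /eqP; rewrite !mulf_eq0 pnatr_eq0 /=.
move=> /orP[/eqP s0|/eqP //].
have : 0 < sin (pi * (h%:R / D%:R) : R).
  have hR : 0 < h%:R :> R by rewrite ltr0n.
  apply: sin_gt0_pi; rewrite mulr_gt0 ?pi_gt0 ?divr_gt0 //=.
  by rewrite gtr_pMr ?pi_gt0 // ltr_pdivrMr // mul1r ltr_nat.
by rewrite s0 ltxx.
Qed.

(** Summing over the translates kills every pair j != l of the double sum; each of the D diagonal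
    pairs contributes D, which cancels the normalisation D^2. *)
Lemma fejer_partition D y : (0 < D)%N ->
  \sum_(k < D) fejer D (y - k%:R / D%:R) = 1.
Proof.
move=> D0.
have DR : 0 < D%:R :> R by rewrite ltr0n.
under eq_bigr do rewrite fejerE.
rewrite -mulr_suml exchange_big /=.
transitivity ((\sum_(j < D) D%:R) / D%:R ^+ 2 : R); last first.
  by rewrite sumr_const card_ord -[_ *+ D]mulr_natr; field; rewrite gt_eqF.
congr (_ / _); apply: eq_bigr => j _.
rewrite exchange_big /= (bigD1 j) //= [X in _ + X]big1 ?addr0; last first.
  move=> l lj.
  have [jl|jl|/val_inj e] := ltngtP (val j) (val l); last by rewrite e eqxx in lj.
  - have := @sum_cos_roots D (l - j) (2 * pi * (j%:R - l%:R) * y).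
    rewrite subn_gt0 jl /= (leq_ltn_trans (leq_subr _ _) (ltn_ord l)) => /(_ isT) h.
    rewrite -[RHS]h.
    apply: eq_bigr => k _; congr cos.
    by rewrite natrB ?(ltnW jl) //; field; rewrite gt_eqF.
  - have := @sum_cos_roots D (j - l) (- (2 * pi * (j%:R - l%:R) * y)).
    rewrite subn_gt0 jl /= (leq_ltn_trans (leq_subr _ _) (ltn_ord j)) => /(_ isT) h.
    rewrite -[RHS]h.
    apply: eq_bigr => k _; rewrite -cosN; congr cos.
    by rewrite natrB ?(ltnW jl) //; field; rewrite gt_eqF.
under eq_bigr do rewrite subrr mulr0 mul0r cos0.
by rewrite sumr_const card_ord.
Qed.

End Trig.

(** * Integrals of Riesz products *)

Section Riesz.
Context {R : realType}.
Variable mu : {finite_measure set (measurableTypeR R) -> \bar R}.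

Lemma continuous_integrable01 (f : R -> R) : continuous f ->
  mu.-integrable `[0, 1] (EFin \o f).
Proof.
move=> cf; apply: measurable_bounded_integrable => //.
- by rewrite ltey_eq fin_num_measure.
- by apply: measurable_funTS; exact: continuous_measurable_fun.
- have := continuous_compact (continuous_subspaceT cf) (@segment_compact R 0 1).
  move=> /compact_bounded [M [Mr HM]]; exists M; split=> // x Mx y y01.
  by apply: HM => //; exists y.
Qed.

Lemma continuous_sum_fun (I : Type) (s : seq I) (P : pred I) (F : I -> R -> R) :
  (forall i, continuous (F i)) ->
  continuous (fun x => \sum_(i <- s | P i) F i x).
Proof.
move=> cF; elim: s => [|i s IH] x.
  by under [X in _ X]eq_fun do rewrite big_nil; exact: cvg_cst.
have -> : (fun x => \sum_(j <- i :: s | P j) F j x) =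
    (fun x => (if P i then F i x else 0) + \sum_(j <- s | P j) F j x).
  by apply/funext => z; rewrite big_cons; case: (P i); rewrite ?add0r.
apply: cvgD; last exact: IH.
by case: (P i); [exact: cF|exact: cvg_cst].
Qed.

Lemma continuous_prod_fun (F : nat -> R -> R) n :
  (forall i, continuous (F i)) -> continuous (fun x => \prod_(i < n) F i x).
Proof.
move=> cF; elim: n => [|n IH] x.
  by under [X in _ X]eq_fun do rewrite big_ord0; exact: cvg_cst.
have -> : (fun x => \prod_(j < n.+1) F j x) =
    (fun x => \prod_(j < n) F j x * F n x).
  by apply/funext => z; rewrite big_ord_recr.
by apply: cvgM; [exact: IH|exact: cF].
Qed.

Lemma continuous_cos_affine (w t : R) : continuous (fun x => cos (w * x + t)).
Proof.
move=> x; apply: (@continuous_comp _ _ _ (fun x => w * x + t) cos); last first.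
  exact: continuous_cos.
by apply: cvgD; [apply: cvgM; [exact: cvg_cst|exact: cvg_id]|exact: cvg_cst].
Qed.

Definition riesz_prod (g : R -> R) (b : nat -> R) (M : nat) (x : R) : R :=
  \prod_(i < M) g (b i.+1 * x).

(** The phase [t] keeps the recursion within real integrals: multiplying by a shifted cosine only
    moves [w] and [t]. *)
Definition riesz_coeff g b M (w t : R) : R :=
  Rintegral mu `[0, 1] (fun x => riesz_prod g b M x * cos (2 * pi * w * x + t)).

Lemma continuous_riesz_prod g b M : continuous g ->
  continuous (riesz_prod g b M).
Proof.
move=> cg; apply: (continuous_prod_fun (fun i x => g (b i.+1 * x))) => i x.
apply: (@continuous_comp _ _ _ (fun x => b i.+1 * x) g); last exact: cg.
by apply: cvgM; [exact: cvg_cst|exact: cvg_id].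
Qed.

Section Expansion.
Variables (P : finType) (p : pred P) (c0 : R) (c d ph : P -> R).
Let g y := c0 + \sum_(i | p i) c i * cos (2 * pi * d i * y + ph i).
Variable (b : nat -> R).

Lemma continuous_trig_poly : continuous g.
Proof.
move=> x; apply: cvgD; first exact: cvg_cst.
apply: (continuous_sum_fun P (index_enum P) p
  (fun i x => c i * cos (2 * pi * d i * x + ph i))) => i z.
by apply: cvgM; [exact: cvg_cst|exact: continuous_cos_affine].
Qed.

Lemma Rintegral_sum01 (F : P -> R -> R) (s : seq P) :
  (forall i, continuous (F i)) ->
  Rintegral mu `[0, 1] (fun x => \sum_(i <- s | p i) F i x) =
  \sum_(i <- s | p i) Rintegral mu `[0, 1] (F i).
Proof.
move=> cF; elim: s => [|i s IH].
  rewrite big_nil; under eq_Rintegral do rewrite big_nil.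
  by rewrite Rintegral_cst ?mul0r.
rewrite big_cons; under eq_Rintegral do rewrite big_cons.
case: (p i) => //.
rewrite RintegralD ?IH //; apply: continuous_integrable01 => //.
exact: continuous_sum_fun.
Qed.

(** The last factor is multiplied out; by the product-to-sum formula each of its cosines splits into
    two opposite frequency shifts. *)
Lemma riesz_coeff_rec M w t : riesz_coeff g b M.+1 w t =
  c0 * riesz_coeff g b M w t + \sum_(i | p i) c i / 2 *
   (riesz_coeff g b M (w + d i * b M.+1) (t + ph i) +
    riesz_coeff g b M (w - d i * b M.+1) (t - ph i)).
Proof.
have cP := continuous_riesz_prod g b M continuous_trig_poly.
have cPc v s : continuous (fun x => riesz_prod g b M x * cos (2 * pi * v * x + s)).
  by move=> x; apply: cvgM; [exact: cP|exact: continuous_cos_affine].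
have iPc v s := continuous_integrable01 _ (cPc v s).
pose F i x := c i / 2 * (riesz_prod g b M x * cos (2 * pi * (w + d i * b M.+1) * x + (t + ph i)) +
   riesz_prod g b M x * cos (2 * pi * (w - d i * b M.+1) * x + (t - ph i))).
have cF i : continuous (F i).
  move=> x; apply: cvgM; first exact: cvg_cst.
  by apply: cvgD; exact: cPc.
transitivity (Rintegral mu `[0, 1] (fun x =>
    c0 * (riesz_prod g b M x * cos (2 * pi * w * x + t)) + \sum_(i | p i) F i x)).
  apply: eq_Rintegral => x _.
  rewrite {1}/riesz_prod big_ord_recr /= -/(riesz_prod g b M x) {2}/g.
  rewrite mulrDr mulrDl; congr (_ + _); first by ring.
  rewrite mulr_sumr mulr_suml; apply: eq_bigr => i _; rewrite /F.
  have -> : 2 * pi * (w + d i * b M.+1) * x + (t + ph i) =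
    (2 * pi * w * x + t) + (2 * pi * d i * (b M.+1 * x) + ph i) by ring.
  have -> : 2 * pi * (w - d i * b M.+1) * x + (t - ph i) =
    (2 * pi * w * x + t) - (2 * pi * d i * (b M.+1 * x) + ph i) by ring.
  set u := 2 * pi * w * x + t; set v := _ + ph i.
  by rewrite (cosB u v) (cosD u v); field.
have cS : continuous (fun x => \sum_(i | p i) F i x) by exact: continuous_sum_fun.
rewrite RintegralD //; last exact: continuous_integrable01.
- rewrite RintegralZl // Rintegral_sum01 //; congr (_ + _).
  apply: eq_bigr => i _; rewrite /F RintegralZl ?RintegralD //.
  apply: continuous_integrable01 => x.
  by apply: cvgD; exact: cPc.
- apply: continuous_integrable01 => x; apply: cvgM; first exact: cvg_cst.
  exact: cPc.
Qed.

Hypothesis d_ge1 : forall i, p i -> 1 <= `|d i|.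
Variable Delta : R.
Hypothesis Delta_ge0 : 0 <= Delta.
Hypothesis d_le : forall i, p i -> `|d i| <= Delta.
Variable B : R.
Hypothesis c0_ge0 : 0 <= c0.
Hypothesis c_le : c0 + \sum_(i | p i) `|c i| <= B.
Variable E : R -> R.
Hypothesis E_ge0 : forall z : R, 0 <= z -> 0 <= E z.
Hypothesis E_ni : forall y z : R, 0 <= y -> y <= z -> E z <= E y.
Hypothesis cos_decay : forall w t,
  `|Rintegral mu `[0, 1] (fun x => cos (2 * pi * w * x + t))| <= E `|w|.
Hypothesis b_gt0 : forall i, 0 < b i.

Let B_ge0 : 0 <= B.
Proof. by apply: le_trans c_le; rewrite addr_ge0 // sumr_ge0. Qed.

Lemma sum_half_le (V : R) (X Y : P -> R) :
  (forall i, p i -> `|X i| <= V) -> (forall i, p i -> `|Y i| <= V) ->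
  `|\sum_(i | p i) c i / 2 * (X i + Y i)| <= (\sum_(i | p i) `|c i|) * V.
Proof.
move=> hX hY; rewrite (le_trans (ler_norm_sum _ _ _)) // mulr_suml.
apply: ler_sum => i pi; rewrite normrM normrM.
have -> : `|2^-1| = 2^-1 :> R by rewrite ger0_norm.
rewrite -mulrA ler_wpM2l //.
have := ler_normD (X i) (Y i); have := hX i pi; have := hY i pi; lra.
Qed.

(* The frequencies occurring in the product are at most
   [Delta * \sum_(i < M) b i.+1], so they cannot cancel a larger [w]. *)
Lemma riesz_coeff_high M (y w t : R) : 0 <= y ->
  y + Delta * \sum_(i < M) b i.+1 <= `|w| ->
  `|riesz_coeff g b M w t| <= B ^+ M * E y.
Proof.
move=> y0; elim: M w t => [|M IH] w t.
  rewrite big_ord0 mulr0 addr0 expr0 mul1r => yw.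
  have -> : riesz_coeff g b 0 w t =
      Rintegral mu `[0, 1] (fun x => cos (2 * pi * w * x + t)).
    by apply: eq_Rintegral => x _; rewrite /riesz_prod big_ord0 mul1r.
  by rewrite (le_trans (cos_decay _ _)) // E_ni.
rewrite big_ord_recr /= => yw; rewrite riesz_coeff_rec.
have dle i : p i -> `|d i * b M.+1| <= Delta * b M.+1.
  by move=> pi; rewrite normrM (gtr0_norm (b_gt0 _)) ler_wpM2r ?d_le // ltW.
have db0 : 0 <= Delta * b M.+1 by rewrite mulr_ge0 // ltW.
have tri (u v : R) : `|u| - `|v| <= `|u + v| by have := lerB_normD u v.
set V := B ^+ M * E y.
have V0 : 0 <= V by rewrite mulr_ge0 ?exprn_ge0 ?E_ge0.
rewrite exprS -mulrA -/V (le_trans (ler_normD _ _)) //.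
apply: (@le_trans _ _ ((c0 + \sum_(i | p i) `|c i|) * V)); last by rewrite ler_wpM2r.
rewrite mulrDl; apply: lerD.
  by rewrite normrM (ger0_norm c0_ge0) ler_wpM2l // IH //; lra.
apply: sum_half_le => i pi; apply: IH.
- by have := tri w (d i * b M.+1); have := dle i pi; lra.
- by have := tri w (- (d i * b M.+1)); rewrite normrN; have := dle i pi; lra.
Qed.

(* Peeling off the last factor: its constant term reproduces the shorter product,
   and all its other terms have frequency at least [b M.+1]. *)
Lemma riesz_coeff0 M (y : R) : 0 <= y ->
  y + Delta * \sum_(i < M) b i.+1 <= b M.+1 ->
  `|riesz_coeff g b M.+1 0 0| <= c0 * `|riesz_coeff g b M 0 0| + B ^+ M.+1 * E y.
Proof.
move=> y0 yb; rewrite riesz_coeff_rec (le_trans (ler_normD _ _)) //.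
have V0 : 0 <= B ^+ M * E y by rewrite mulr_ge0 ?exprn_ge0 ?E_ge0.
apply: lerD; first by rewrite normrM (ger0_norm c0_ge0).
apply: (@le_trans _ _ ((\sum_(i | p i) `|c i|) * (B ^+ M * E y))); last first.
  by rewrite exprS -mulrA ler_wpM2r //; move: c_le c0_ge0; lra.
have ble i : p i -> b M.+1 <= `|d i * b M.+1|.
  by move=> pi; rewrite normrM (gtr0_norm (b_gt0 _)) ler_peMl ?d_ge1 // ltW.
apply: sum_half_le => i pi; apply: riesz_coeff_high => //.
- by rewrite add0r (le_trans yb) // ble.
- by rewrite sub0r normrN (le_trans yb) // ble.
Qed.

Variable Q : R.
Hypothesis Delta_ge1 : 1 <= Delta.
Hypothesis Q_ge : 4 * Delta <= Q.
Hypothesis b0_ge1 : 1 <= b 0.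
Hypothesis b_growth : forall i, Q * b i <= b i.+1.

Let Q_gt0 : 0 < Q.
Proof. by move: Delta_ge1 Q_ge; lra. Qed.

(** Growth by [Q >= 4 * Delta] lets the next term dominate all earlier frequencies together, leaving
    half of it as the margin [y] in [riesz_coeff0]. *)
Let b_sum M : Delta * \sum_(i < M) b i.+1 <= b M.+1 / 2.
Proof.
elim: M => [|M IH]; first by rewrite big_ord0 mulr0 divr_ge0 // ltW.
rewrite big_ord_recr /= mulrDr.
have b1 := b_gt0 M.+1; have h := b_growth M.+1.
by move: Delta_ge1 Q_ge => D1 Q1; nra.
Qed.

Let b_ge M : Q ^+ M <= b M.
Proof.
elim: M => [|M IH]; first by rewrite expr0.
by rewrite exprS (le_trans _ (b_growth M)) // ler_wpM2l // ltW.
Qed.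

Variables (H Ups : R).
Hypothesis H_ge0 : 0 <= H.
Hypothesis Ups_ge0 : 0 <= Ups.
Hypothesis E_def : forall z : R, E z = H * (1 + z) `^ (- Ups).
Hypothesis Q_Ups : 4 * B <= (Q / 2) `^ Ups.
Hypothesis B_gt0 : 0 < B.
Hypothesis c0_ge : 1 / 2 <= c0.

(** Each peeled factor multiplies the integral by [c0] and adds an error. Relative to the current
    power of [c0] these errors are at most H/2, H/4, and so on, so they sum to at most [H]. *)
Lemma riesz_coeff0_le M :
  `|riesz_coeff g b M 0 0| <= c0 ^+ M * (fine (mu `[0%R, 1%R]%classic) + H).
Proof.
(* The induction carries the exact partial sum of the geometric errors. *)
suff : `|riesz_coeff g b M 0 0| <=
    c0 ^+ M * (fine (mu `[0%R, 1%R]%classic) + H * (1 - 2^-1 ^+ M)).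
  move=> h; apply: (le_trans h); rewrite ler_wpM2l ?exprn_ge0 // lerD2l.
  by rewrite ler_piMr // gerBl exprn_ge0.
elim: M => [|M IH].
  have -> : riesz_coeff g b 0 0 0 = Rintegral mu `[0, 1] (fun=> 1).
    apply: eq_Rintegral => x _.
    by rewrite /riesz_prod big_ord0 mulr0 mul0r addr0 cos0 mul1r.
  by rewrite Rintegral_cst // mul1r !expr0 subrr mulr0 addr0 mul1r ger0_norm // fine_ge0.
have y0 : 0 <= b M.+1 / 2 by rewrite divr_ge0 // ltW.
have := @riesz_coeff0 M (b M.+1 / 2) y0.
have yb : b M.+1 / 2 + Delta * \sum_(i < M) b i.+1 <= b M.+1.
  by have := b_sum M; lra.
move=> /(_ yb) h; apply: (le_trans h).
have Q2 : 0 < Q / 2 by rewrite divr_gt0.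
(* Since [b M.+1] is at least [Q ^+ M.+1], the decay beats [(4 * B) ^+ M.+1]. The remaining power of
   1/4 is split using [c0 >= 1 / 2]. *)
have tail : B ^+ M.+1 * E (b M.+1 / 2) <= H * (c0 ^+ M.+1 * 2^-1 ^+ M.+1).
  rewrite E_def mulrCA ler_wpM2l //.
  have h1 : (4 * B) ^+ M.+1 <= (1 + b M.+1 / 2) `^ Ups.
    apply: (@le_trans _ _ (((Q / 2) `^ Ups) ^+ M.+1)).
      by rewrite lerXn2r // nnegrE ?powR_ge0 // mulr_ge0.
    rewrite -powR_mulrn ?powR_ge0 // -powRrM (mulrC Ups) powRrM powR_mulrn ?(ltW Q2) //.
    have hb : (Q / 2) ^+ M.+1 <= 1 + b M.+1 / 2.
      apply: (@le_trans _ _ (Q ^+ M.+1 / 2)); last by have := b_ge M.+1; lra.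
      rewrite exprMn ler_wpM2l ?exprn_ge0 ?(ltW Q_gt0) // exprS ler_piMr //.
      by rewrite exprn_ile1 //; lra.
    have hq : 0 <= (Q / 2) ^+ M.+1 by rewrite exprn_ge0 // ltW.
    by apply: ge0_ler_powR => //; rewrite nnegrE ?(le_trans hq).
  have B4 : 0 < (4 * B) ^+ M.+1 by rewrite exprn_gt0 // mulr_gt0.
  rewrite powRN; apply: (@le_trans _ _ (B ^+ M.+1 * ((4 * B) ^+ M.+1)^-1)).
    rewrite ler_wpM2l ?exprn_ge0 // lef_pV2 // posrE //.
    exact: lt_le_trans h1.
  rewrite -exprVn -!exprMn lerXn2r ?nnegrE //.
  - by rewrite mulr_ge0 // invr_ge0 mulr_ge0.
  - by rewrite mulr_ge0.
  have -> : B * (4 * B)^-1 = 4^-1 by field; rewrite gt_eqF.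
  by move: c0_ge; lra.
have {}IH := ler_wpM2l c0_ge0 IH.
apply: (le_trans (lerD IH tail)).
rewrite !exprS; set q := 2^-1 ^+ M; set w := c0 ^+ M.
rewrite le_eqVlt; apply/orP; left; apply/eqP; by field.
Qed.

End Expansion.
End Riesz.

(** * Gaps and cutoff functions *)

Section Gaps.
Context {R : realType}.
Implicit Types (t u x y delta : R) (z : seq R).

(** The left endpoint of a largest gap serves as [t]. Quantifying over integer shifts encodes the
    torus, including the gap that wraps around. *)
Lemma max_gap_gt z delta : 0 <= delta -> delta < max_gap z ->
  exists t, 0 <= t < 1 /\
    forall u, u \in z -> forall n : int, ~ (t < u + n%:~R < t + delta).
Proof.
move=> d0 dz.
pose y := sort <=%R [seq frac_part t | t <- z].
have sy : size y = size z by rewrite size_sort size_map.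
have y_sorted : sorted <=%R y by apply: sort_sorted; exact: le_total.
have y_le i j : (i <= j)%N -> (j < size z)%N -> y`_i <= y`_j.
  move=> ij jz.
  apply: (@sorted_leq_nth _ <=%R le_trans lexx 0 y y_sorted) => //.
  - by rewrite inE sy (leq_ltn_trans ij).
  - by rewrite inE sy.
have yP v : v \in y -> 0 <= v < 1.
  rewrite mem_sort => /mapP[w _ ->]; rewrite /frac_part subr_ge0 ltrBlDr addrC.
  by have := Num.Theory.floor_itv w; rewrite intrD.
have [k kz kd] : exists2 k, (k < size z)%N &
    delta < (torus_points z)`_k.+1 - (torus_points z)`_k.
  apply: contrapT => h; move: dz; rewrite ltNge => /negP; apply.
  rewrite /max_gap big_nat; apply: bigmax_le => // k /andP[_ kz].
  by rewrite leNgt; apply/negP => kd; apply: h; exists k.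
have Yk : (torus_points z)`_k = y`_k by rewrite /torus_points nth_rcons sy kz.
have yk : 0 <= y`_k < 1 by apply: yP; rewrite mem_nth // sy.
exists y`_k; split=> // u uz n /andP[h1 h2].
have fy : frac_part u \in y by rewrite mem_sort map_f.
set f := frac_part u in fy.
have jz : (index f y < size z)%N by rewrite -sy index_mem.
have fj : y`_(index f y) = f by rewrite nth_index.
have /andP[f0 f1] := yP _ fy.
have eu : u + n%:~R = f + (Num.floor u + n)%:~R.
  by rewrite /f /frac_part intrD; ring.
rewrite eu in h1 h2.
(* This covers the wrap-around entry too, which is 1 plus the least representative. *)
have Y1 : (torus_points z)`_k.+1 <= 1 + f.
  rewrite /torus_points nth_rcons -/y sy; case: ltnP => k1.
    have k1' : (k.+1 < size y)%N by rewrite sy.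
    by have /andP[_] := yP _ (mem_nth 0 k1'); lra.
  rewrite eqn_leq kz k1 /= -nth0 lerD2l -fj; exact: y_le.
move: kd; rewrite Yk => kd.
(* A shift of 1 or more would pass the right end of the gap, by [Y1]; a shift of -1 or less would
   make the point negative. *)
have n0 : (Num.floor u + n) = 0.
  apply/eqP; rewrite eq_le -ltzD1 -[0 <= _]ltzD1 add0r.
  move: yk => /andP[yk0 yk1].
  rewrite -[_ < 1](ltr_int R) -[0 < _](ltr_int R) intrD.
  by apply/andP; split; lra.
rewrite n0 addr0 in h1 h2.
have [jk|kj] := leqP (index f y) k.
  by have := y_le _ _ jk kz; rewrite fj; lra.
have k1 := leq_ltn_trans kj jz.
move: kd; rewrite /torus_points nth_rcons -/y sy k1.
have := y_le _ _ kj jz; rewrite fj; lra.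
Qed.

(* The [m] translates are centred in the middle half of the gap, hence stay at
   distance at least [delta / 4] from every point outside it. *)
Lemma fejer_sum_gap (D m : nat) t delta : (0 < D)%N -> 0 < delta <= 1 ->
  m%:R <= delta * D%:R / 2 -> 0 <= t < 1 ->
  exists2 k0, (k0 < 3 * D)%N &
    forall x, (forall n : int, ~ (t < x + n%:~R < t + delta)) ->
      \sum_(k < m) fejer D (x - k0%:R / D%:R - k%:R / D%:R) <=
      16 / (D%:R * delta).
Proof.
move=> D0 /andP[d0 d1] mD /andP[t0 t1].
have DR : 1 <= D%:R :> R by rewrite ler1n.
set w := (t + delta / 4) * D%:R.
have w0 : 0 <= w by rewrite mulr_ge0 //; lra.
have /andP[k1 k2] := Num.Theory.truncn_itv w0.
(* The first grid point k0/D beyond t + delta/4; the [m] consecutive grid points from there end by t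
   + 3 delta/4. *)
set k0 := (Num.truncn w).+1; rewrite -/k0 in k2.
have {}k1 : k0%:R <= w + 1 by rewrite /k0 -natr1; lra.
exists k0.
  by rewrite -(ltr_nat R) natrM; apply: (le_lt_trans k1); rewrite /w; nra.
move=> x hx.
have D0' : 0 < D%:R :> R by lra.
have term (k : 'I_m) : fejer D (x - k0%:R / D%:R - k%:R / D%:R) <=
    2 / (D%:R * (delta / 4)) ^+ 2.
  apply: fejer_le => [|n]; first by rewrite divr_gt0.
  rewrite leNgt; apply/negP; rewrite ltr_norml => /andP[n1 n2].
  apply: (hx n).
  have km : k%:R + 1 <= m%:R :> R by rewrite natr1 ler_nat.
  have k0' : 0 <= k%:R :> R by [].
  have v1 : t + delta / 4 < (k0%:R + k%:R) / D%:R.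
    by rewrite ltr_pdivlMr // -/w; lra.
  have v2 : (k0%:R + k%:R) / D%:R <= t + delta / 4 * 3.
    by rewrite ler_pdivrMr //; rewrite /w in k1; lra.
  by rewrite mulrDl in v1 v2; apply/andP; split; lra.
apply: (le_trans (ler_sum _ (fun k _ => term k))).
rewrite sumr_const card_ord -[_ *+ m]mulr_natr.
have -> : 16 / (D%:R * delta) =
    2 / (D%:R * (delta / 4)) ^+ 2 * (delta * D%:R / 2).
  by field; rewrite !gt_eqF.
by rewrite ler_wpM2l // divr_ge0 // sqr_ge0.
Qed.

(** The function g of the overview, for an interval positioned by [s]; [eta] compensates for the
    Fejer tails outside it. *)
Definition cutoff (D m : nat) (eta s y : R) : R :=
  1 + eta - \sum_(k < m) fejer D (y - s - k%:R / D%:R).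

(** The subtracted translates are part of the partition of unity [fejer_partition]. *)
Lemma cutoff_ge0 D m eta s y : (0 < D)%N -> (m <= D)%N -> 0 <= eta ->
  0 <= cutoff D m eta s y.
Proof.
move=> D0 mD e0; rewrite /cutoff subr_ge0 (@le_trans _ _ 1) ?lerDl //.
rewrite -[leRHS](fejer_partition D (y - s) D0).
rewrite -(big_mkord xpredT (fun k => fejer D (y - s - k%:R / D%:R))).
rewrite -(big_mkord xpredT (fun k => fejer D (y - s - k%:R / D%:R))).
rewrite (big_cat_nat (leq0n m) mD) //= lerDl.
by apply: sumr_ge0 => k _; exact: fejer_ge0.
Qed.

Lemma sum_pair (I J : finType) (F : I * J -> R) :
  \sum_p F p = \sum_i \sum_j F (i, j).
Proof.
by rewrite (pair_bigA _ (fun i j => F (i, j))); apply: eq_bigr => -[].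
Qed.

(** The diagonal pairs of the Fejer double sums form the constant term; the others have nonzero
    integer frequencies, the shape required for the Riesz product estimates. *)
Lemma cutoffE D m eta s y : (0 < D)%N ->
  cutoff D m eta s y = 1 + eta - m%:R / D%:R +
  \sum_(i : 'I_m * ('I_D * 'I_D) | i.2.1 != i.2.2)
     - (D%:R ^- 2) * cos (2 * pi * (i.2.1%:R - i.2.2%:R) * y +
        - (2 * pi * (i.2.1%:R - i.2.2%:R) * (s + i.1%:R / D%:R))).
Proof.
move=> D0; have DR : 0 < D%:R :> R by rewrite ltr0n.
rewrite /cutoff -[in RHS]addrA; congr (_ + _).
pose F (i : 'I_m * ('I_D * 'I_D)) := D%:R ^- 2 *
  cos (2 * pi * (i.2.1%:R - i.2.2%:R) * (y - s - i.1%:R / D%:R) : R).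
have -> : \sum_(k < m) fejer D (y - s - k%:R / D%:R) = \sum_i F i.
  rewrite sum_pair; apply: eq_bigr => k _.
  rewrite fejerE mulrC mulr_sumr.
  rewrite sum_pair; apply: eq_bigr => j _.
  by rewrite mulr_sumr.
rewrite (bigID (fun i : 'I_m * ('I_D * 'I_D) => i.2.1 == i.2.2)) /= opprD.
congr (- _ + _); last first.
  rewrite -sumrN; apply: eq_bigr => i _; rewrite /F mulNr; congr (- (_ * cos _)).
  by ring.
have -> : \sum_(i : 'I_m * ('I_D * 'I_D) | i.2.1 == i.2.2) F i =
    \sum_(k < m) \sum_(j < D) D%:R ^- 2.
  under eq_bigr => i /eqP h do
    rewrite /F h subrr mulr0 !mul0r cos0 mulr1.
  rewrite -(pair_big_dep xpredT (fun _ (q : 'I_D * 'I_D) => q.1 == q.2)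
     (fun _ _ => D%:R ^- 2)) /=.
  apply: eq_bigr => k _.
  rewrite -(pair_big_dep xpredT (fun j l : 'I_D => j == l)
     (fun _ _ => D%:R ^- 2)) /=.
  by apply: eq_bigr => j _; rewrite (big_pred1 j) // => l; rewrite /= eq_sym.
rewrite !sumr_const !card_ord -!mulrnA -[_ *+ _]mulr_natr natrM.
by field; rewrite gt_eqF.
Qed.

Lemma continuous_cutoff D m eta s : (0 < D)%N -> continuous (cutoff D m eta s).
Proof.
move=> D0.
rewrite (funext (fun y => cutoffE D m eta s y D0)).
exact: (@continuous_trig_poly R ('I_m * ('I_D * 'I_D))%type
  (fun i => i.2.1 != i.2.2) _ (fun=> - D%:R ^- 2)
  (fun i => i.2.1%:R - i.2.2%:R)
  (fun i => - (2 * pi * (i.2.1%:R - i.2.2%:R) * (s + i.1%:R / D%:R)))).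
Qed.

(* The factor 2 comes from splitting off the phase [t]. *)
Lemma cos_decay_of_fourier (mu : {finite_measure set (measurableTypeR R) -> \bar R})
    (E : R -> R) :
  (forall x, `|fourier mu x| <= ((E x)%:C)%C) ->
  forall w t, `|Rintegral mu `[0, 1] (fun x => cos (2 * pi * w * x + t))| <=
    2 * E w.
Proof.
move=> h w t.
have ccos : continuous (fun x : R => cos (2 * pi * w * x)).
  move=> x; have := continuous_cos_affine (2 * pi * w) 0 x.
  by under [X in continuous_at _ X]eq_fun do rewrite addr0.
have csin : continuous (fun x : R => sin (2 * pi * w * x)).
  move=> x; have := continuous_cos_affine (2 * pi * w) (- (pi / 2)) x.
  by under [X in continuous_at _ X]eq_fun do rewrite cosBpihalf.
set Ic := Rintegral mu `[0, 1] (fun x => cos (2 * pi * w * x)).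
set Is := Rintegral mu `[0, 1] (fun x => sin (2 * pi * w * x)).
have eI : Rintegral mu `[0, 1] (fun x => cos (2 * pi * w * x + t)) =
    cos t * Ic - sin t * Is.
  under eq_Rintegral do rewrite cosD [X in X - _]mulrC [X in _ - X]mulrC.
  have icos := continuous_integrable01 mu _ ccos.
  have isin := continuous_integrable01 mu _ csin.
  rewrite RintegralB ?RintegralZl //.
  - apply: (continuous_integrable01 mu (fun x => cos t * cos (2 * pi * w * x))).
    by move=> x; apply: cvgM; [exact: cvg_cst|exact: ccos].
  - apply: (continuous_integrable01 mu (fun x => sin t * sin (2 * pi * w * x))).
    by move=> x; apply: cvgM; [exact: cvg_cst|exact: csin].
have := h w; rewrite /fourier /Cintegral /=.
have -> : Rintegral mu `[0, 1] (fun x => cos (- (2 * pi * x * w))) = Ic.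
  by apply: eq_Rintegral => x _; rewrite cosN; congr cos; ring.
have -> : Rintegral mu `[0, 1] (fun x => sin (- (2 * pi * x * w))) = - Is.
  rewrite -mulN1r -RintegralZl //; last exact: continuous_integrable01.
  by apply: eq_Rintegral => x _; rewrite sinN mulN1r; congr (- sin _); ring.
rewrite normc_def lecR /= => hE.
have hc : `|Ic| <= E w.
  by rewrite (le_trans _ hE) // -sqrtr_sqr ler_wsqrtr // lerDl sqr_ge0.
have hs : `|Is| <= E w.
  by rewrite (le_trans _ hE) // -sqrtr_sqr ler_wsqrtr // sqrrN lerDr sqr_ge0.
rewrite eI (le_trans (ler_normB _ _)) // !normrM.
have := cos_max t; have := sin_max t.
have := normr_ge0 Ic; have := normr_ge0 Is.
have := normr_ge0 (cos t); have := normr_ge0 (sin t); nra.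
Qed.

Lemma markov01 (mu : {finite_measure set (measurableTypeR R) -> \bar R})
    (f : R -> R) : continuous f -> (forall x, 0 <= f x) ->
  measurable (`[0, 1]%classic `&` [set x | 1 <= f x] : set (measurableTypeR R)) /\
  (mu (`[0%R, 1%R]%classic `&` [set x | (1 <= f x)%R]) <=
    (Rintegral mu `[0, 1] f)%:E)%E.
Proof.
move=> cf f0.
have mf : measurable_fun (setT : set (measurableTypeR R)) f.
  exact: continuous_measurable_fun.
have mA : measurable (`[0, 1]%classic `&` [set x | 1 <= f x] : set (measurableTypeR R)).
  apply: measurableI => //.
  have -> : [set x | 1 <= f x] = f @^-1` `[1, +oo[.
    by apply/seteqP; split => x /=; rewrite in_itv /= andbT.
  by rewrite -[X in measurable X]setTI; apply: mf.
split=> //.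
have If := continuous_integrable01 mu _ cf.
rewrite /Rintegral fineK; last exact: integrable_fin_num.
set A := _ `&` _ in mA *.
have mfE D : measurable_fun (D : set (measurableTypeR R)) (fun x => (f x)%:E).
  by apply/measurable_EFinP; exact: measurable_funTS.
apply: (@le_trans _ _ (\int[mu]_(x in A) (f x)%:E)%E).
  rewrite -[leLHS]mul1e -integral_cst //.
  by apply: ge0_le_integral => // x [_ /=]; rewrite lee_fin.
apply: ge0_subset_integral => //; last exact: subIsetl.
by move=> x _; rewrite lee_fin.
Qed.

End Gaps.

(** * Measure of the set with a large gap *)

Section GapMeasure.
Context {R : realType}.
Variable mu : {finite_measure set (measurableTypeR R) -> \bar R}.
Variables (H Ups : R).
Hypothesis H_ge0 : 0 <= H.
Hypothesis Ups_ge0 : 0 <= Ups.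
Hypothesis cos_decay : forall w t,
  `|Rintegral mu `[0, 1] (fun x => cos (2 * pi * w * x + t))| <=
    H * (1 + `|w|) `^ (- Ups).

Lemma riesz_cutoff_le (D m : nat) (eta s Q : R) (b : nat -> R) (M : nat) :
  (0 < D)%N -> 0 <= eta -> eta <= m%:R / D%:R -> m%:R / D%:R <= 1 / 2 :> R ->
  4 * D%:R <= Q -> 8 * D%:R <= (Q / 2) `^ Ups ->
  1 <= b 0 -> (forall i, Q * b i <= b i.+1) ->
  Rintegral mu `[0, 1] (riesz_prod (cutoff D m eta s) b M) <=
    (1 + eta - m%:R / D%:R) ^+ M * (fine (mu `[0%R, 1%R]%classic) + H).
Proof.
move=> D0 e0 em mD QD QU b0 bQ.
have DR : 1 <= D%:R :> R by rewrite ler1n.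
have Q0 : 0 < Q by lra.
have bp i : 0 < b i.
  elim: i => [|i IH]; first by lra.
  by apply: lt_le_trans (bQ i); rewrite mulr_gt0.
rewrite (funext (fun y => cutoffE D m eta s y D0)).
pose p (i : 'I_m * ('I_D * 'I_D)) := i.2.1 != i.2.2.
pose d (i : 'I_m * ('I_D * 'I_D)) : R := i.2.1%:R - i.2.2%:R.
have d1 i : p i -> 1 <= `|d i|.
  rewrite /p /d neq_ltn => /orP[]; rewrite -(ler_nat R) -natr1 => h.
    by rewrite distrC ger0_norm; lra.
  by rewrite ger0_norm; lra.
have dD i : p i -> `|d i| <= D%:R.
  move=> _; rewrite /d.
  have h1 : i.2.1%:R <= D%:R :> R by rewrite ler_nat ltnW.
  have h2 : i.2.2%:R <= D%:R :> R by rewrite ler_nat ltnW.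
  have h3 : 0 <= i.2.1%:R :> R by [].
  have h4 : 0 <= i.2.2%:R :> R by [].
  by rewrite ler_norml; apply/andP; split; lra.
(* At most m D^2 coefficients of size D^-2 add up to at most m <= D/2, and the constant term is at
   most 1. With B = 2D, the condition on 4B becomes the hypothesis on 8D. *)
have cB : 1 + eta - m%:R / D%:R + \sum_(i | p i) `|- (D%:R ^- 2) : R| <= 2 * D%:R.
  have : \sum_(i | p i) `|- (D%:R ^- 2) : R| <= m%:R.
    apply: (@le_trans _ _ (\sum_(i : 'I_m * ('I_D * 'I_D)) D%:R ^- 2)).
      rewrite [leRHS](bigID p) /= (@eq_bigr _ _ _ _ _ p _ (fun=> D%:R ^- 2)).
        by rewrite lerDl sumr_ge0 // => i _; rewrite invr_ge0 sqr_ge0.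
      by move=> i _; rewrite normrN ger0_norm // invr_ge0 sqr_ge0.
    rewrite sumr_const card_prod card_prod !card_ord -[_ *+ _]mulr_natr !natrM.
    by rewrite le_eqVlt; apply/orP; left; apply/eqP; field; rewrite gt_eqF //; lra.
  have : m%:R <= D%:R / 2 :> R by move: mD; rewrite ler_pdivrMr; lra.
  by lra.
set g := (X in riesz_prod X b M).
apply: (@le_trans _ _ (riesz_coeff mu g b M 0 0)).
  rewrite le_eqVlt; apply/orP; left; apply/eqP; apply: eq_Rintegral => x _.
  by rewrite mulr0 mul0r addr0 cos0 mulr1.
apply: (le_trans (ler_norm _)).
apply: (@riesz_coeff0_le R mu _ p _ (fun=> - D%:R ^- 2) d _ b d1 D%:R _ dD
  (2 * D%:R) _ cB (fun z => H * (1 + z) `^ (- Ups)) _ _ _ bp Q DR QD b0 bQ H Ups)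
  => //; try lra.
- by move=> z _; rewrite mulr_ge0 // powR_ge0.
- move=> y z y0 yz; rewrite ler_wpM2l // !powRN lef_pV2 ?posrE ?powR_gt0 //; try lra.
  by apply: ge0_ler_powR => //; rewrite ?nnegrE; lra.
Qed.

(** [S] is the union, over 3D grid positions, of the sets where the Riesz product is at least 1.
    Markov's inequality bounds each of them, and 1 - delta/8 <= exp(-delta/8) gives the
    exponential. *)
Lemma gap_measure (D : nat) (delta Q : R) (b : nat -> R) (M : nat) :
  0 < delta <= 1 -> 128 <= D%:R * delta ^+ 2 ->
  4 * D%:R <= Q -> 8 * D%:R <= (Q / 2) `^ Ups ->
  1 <= b 0 -> (forall i, Q * b i <= b i.+1) ->
  exists S : set (measurableTypeR R), [/\ measurable S,
    (mu S <= (3 * D%:R * (expR (- (delta * M%:R / 8)) *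
       (fine (mu `[0%R, 1%R]%classic) + H)))%:E)%E &
    forall x, 0 <= x <= 1 ->
      (exists t, 0 <= t < 1 /\ forall i, (i < M)%N -> forall n : int,
         ~ (t < x * b i.+1 + n%:~R < t + delta)) -> S x].
Proof.
move=> d01 Dd QD QU b0 bQ; have /andP[d0 d1] := d01.
have D0 : (0 < D)%N.
  by rewrite lt0n; apply/eqP => e; move: Dd; rewrite e mul0r; lra.
have D0' : 0 < D%:R :> R by rewrite ltr0n.
have Dd4 : 128 <= D%:R * delta by move: Dd; nra.
have w0 : 0 <= delta * D%:R / 2 by lra.
have /andP[m1 m2] := Num.Theory.truncn_itv w0.
set m := Num.truncn _ in m1 m2; rewrite -(natr1 m) in m2.
(* This is the tail bound of [fejer_sum_gap]. As D delta^2 >= 128, it is at most delta/8, half of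
   the lower bound delta/4 for m/D. *)
set eta := 16 / (D%:R * delta).
have mD4 : delta / 4 <= m%:R / D%:R by rewrite ler_pdivlMr //; lra.
have mD2 : m%:R / D%:R <= delta / 2.
  by rewrite ler_pdivrMr //; move: m1; lra.
have e8 : eta <= delta / 8.
  by rewrite /eta ler_pdivrMr ?mulr_gt0 //; move: Dd; nra.
have e0 : 0 <= eta by rewrite /eta divr_ge0 // mulr_ge0 // ltW.
have mDn : (m <= D)%N.
  rewrite -(ler_nat R) (le_trans m1) // ler_pdivrMr //.
  by have : delta * D%:R <= 1 * D%:R; [rewrite ler_wpM2r // ltW|lra].
pose f (k : nat) := riesz_prod (cutoff D m eta (k%:R / D%:R)) b M.
have cf k : continuous (f k).
  by apply: continuous_riesz_prod; exact: continuous_cutoff.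
have f0 k x : 0 <= f k x by apply: prodr_ge0 => i _; exact: cutoff_ge0.
have W0 : 0 <= fine (mu `[0%R, 1%R]%classic) + H by rewrite addr_ge0 // fine_ge0.
have fI k : Rintegral mu `[0, 1] (f k) <= expR (- (delta * M%:R / 8)) *
       (fine (mu `[0%R, 1%R]%classic) + H).
  apply: (le_trans (@riesz_cutoff_le D m eta _ Q b M _ _ _ _ _ _ _ _)) => //.
  - by lra.
  - by lra.
  rewrite ler_wpM2r //.
  have -> : - (delta * M%:R / 8) = M%:R * (- (delta / 8)) by ring.
  rewrite expRM_natl lerXn2r ?nnegrE ?expR_ge0 //; first by lra.
  by have := expR_ge1Dx (- (delta / 8)); lra.
pose A k : set (measurableTypeR R) := `[0%R, 1%R]%classic `&` [set x | 1 <= f k x].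
have mk k := markov01 mu (f k) (cf k) (f0 k).
exists (\big[setU/set0]_(k < 3 * D) A k); split.
- by apply: bigsetU_measurable => k _; exact: (mk k).1.
- apply: (le_trans (Boole_inequality _ _)); first by move=> k _; exact: (mk k).1.
  apply: (@le_trans _ _ (\sum_(k < 3 * D) (expR (- (delta * M%:R / 8)) *
       (fine (mu `[0%R, 1%R]%classic) + H))%:E)%E).
    by apply: lee_sum => k _; apply: (le_trans (mk k).2); rewrite lee_fin.
  rewrite sumEFin lee_fin sumr_const card_ord -[_ *+ _]mulr_natl.
  by rewrite natrM.
- move=> x x01 [t [t01 ht]].
  have [k0 k0D hk] := fejer_sum_gap D m t delta D0 d01 m1 t01.
  rewrite -bigcup_mkord; exists k0 => //; split; first by rewrite /= in_itv.
  (* Every factor is at least 1, because the corresponding point avoids the interval. *)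
  rewrite /= /f /riesz_prod; elim/big_ind : _ => // [y z y1 z1|i _]; first by nra.
  rewrite [b _ * x]mulrC /cutoff.
  by have := hk _ (ht i (ltn_ord i)); rewrite -/eta; lra.
Qed.

End GapMeasure.

(** * Large gaps along a lacunary sequence, and summability *)

Section LargeGaps.
Context {R : realType}.

(** Writing ln x = 2 ln s with s the square root of x, the bound ln s <= s reduces the claim to 2p
    <= s. *)
Lemma powR_le_expR (p x : R) : 0 <= p -> 1 <= x -> 4 * p ^+ 2 <= x ->
  x `^ p <= expR x.
Proof.
move=> p0 x1 px; have x0 : 0 < x by lra.
rewrite /powR gt_eqF // ler_expR.
set s := Num.sqrt x.
have s0 : 0 < s by rewrite sqrtr_gt0.
have sx : s ^+ 2 = x by rewrite sqr_sqrtr // ltW.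
have -> : ln x = 2 * ln s by rewrite -[in LHS]sx lnXn // mulr_natl.
have ls := ln_sublinear s0.
have ps : 2 * p <= s.
  rewrite -(@ler_pXn2r _ 2) ?nnegrE ?(ltW s0) //; last by lra.
  by rewrite sx; apply: le_trans px; rewrite exprMn; lra.
have : p * ln s <= p * s by rewrite ler_wpM2l // ltW.
by rewrite -sx; nra.
Qed.

Lemma lacunary_iter (r : R) (a : nat -> nat) : 0 <= r ->
  lacunary1 r (fun n : nat => (a n)%:R) ->
  forall k n, (0 < n)%N -> r ^+ k * (a n)%:R <= (a (n + k)%N)%:R.
Proof.
move=> r0 ha k n n0; elim: k => [|k IH]; first by rewrite addn0 expr0 mul1r.
rewrite addnS exprS -mulrA (le_trans _ (ha _ _)) ?addn_gt0 ?n0 //.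
by rewrite ler_wpM2l.
Qed.

Variable mu : {finite_measure set (measurableTypeR R) -> \bar R}.
Variables (H Ups : R).
Hypothesis H_ge0 : 0 <= H.
Hypothesis Ups_gt0 : 0 < Ups.
Hypothesis cos_decay : forall w t,
  `|Rintegral mu `[0, 1] (fun x => cos (2 * pi * w * x + t))| <=
    H * (1 + `|w|) `^ (- Ups).

(** The bound is stated with N(N+1) in the denominator so that the later summation telescopes. *)
Lemma large_gap_measure (eps r : R) (a : nat -> nat) : 0 < eps -> 1 < r ->
  positive_seq1 a -> lacunary1 r (fun n : nat => (a n)%:R) ->
  exists T : R, forall N : nat, (0 < N)%N -> T <= ln N%:R ->
  exists S : set (measurableTypeR R), [/\ measurable S,
    (mu S <= (3 * (fine (mu `[0%R, 1%R]%classic) + H) /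
                (N%:R * (N%:R + 1)))%:E)%E &
    forall x, 0 <= x <= 1 ->
      (ln N%:R) `^ (2 + eps) / N%:R <
        max_gap [seq x * (a n)%:R | n <- iota 1 N] -> S x].
Proof.
move=> eps0 r1 a_pos a_lac.
have lr0 : 0 < ln r by rewrite ln_gt0.
(* It gives Q >= N^(4/Ups) N^5: raised to the power [Ups], the first factor yields N^4 >= 8D, and
   the second exceeds 4D. *)
pose q := 4 / Ups + 5.
have U4 : 0 < 4 / Ups by rewrite divr_gt0.
pose kap := q / ln r + 1.
have q_gt0 : 0 < q by rewrite /q; lra.
have qr0 : 0 < q / ln r by rewrite divr_gt0.
have kap1 : 1 <= kap by rewrite /kap; lra.
(* With K <= kap log N and M K >= N/2, this constant gives delta M / 8 >= 6 log N. *)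
pose V := 96 * kap.
have V0 : 0 < V by rewrite /V; lra.
(* The second summand ensures (log N)^(2+eps) <= N, that is delta <= 1; the third ensures (log
   N)^eps >= V. *)
exists (128 + 4 * (2 + eps) ^+ 2 + V `^ eps^-1) => N N0.
set L := ln N%:R => TL.
have NR : 0 < N%:R :> R by rewrite ltr0n.
have expL : expR L = N%:R by rewrite /L lnK.
have V1 : 0 <= V `^ eps^-1 by exact: powR_ge0.
have p2 : 0 <= 4 * (2 + eps) ^+ 2 by rewrite mulr_ge0 // sqr_ge0.
have L128 : 128 <= L by lra.
have L0 : 0 < L by lra.
have VL : V <= L `^ eps.
  apply: (@le_trans _ _ ((V `^ eps^-1) `^ eps)).
    by rewrite -powRrM mulVf ?gt_eqF // powRr1 // ltW.
  by apply: ge0_ler_powR; rewrite ?nnegrE ?(ltW eps0) ?(ltW L0) //; lra.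
have LN : L `^ (2 + eps) <= N%:R.
  by rewrite -expL; apply: powR_le_expR; lra.
have Lpow : L `^ (2 + eps) = L ^+ 2 * L `^ eps.
  by rewrite powRD ?(gt_eqF L0) ?implybT // powR_mulrn // ltW.
set P := L `^ (2 + eps) in LN Lpow *.
have L2 : L <= L ^+ 2 by rewrite expr2; nra.
have PV : L ^+ 2 * V <= P by rewrite Lpow ler_wpM2l // sqr_ge0.
have N128 : 128 <= N%:R :> R.
  by rewrite -expL; have := expR_ge1Dx L; lra.
pose delta := P / N%:R.
have P1 : 1 <= P by move: PV; rewrite /V; nra.
have d0 : 0 < delta by rewrite divr_gt0 //; lra.
have d1 : delta <= 1 by rewrite ler_pdivrMr // mul1r.
pose D := (N ^ 3)%N.
have DE : D%:R = N%:R ^+ 3 :> R by rewrite natrX.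
have Dd : 128 <= D%:R * delta ^+ 2.
  have -> : D%:R * delta ^+ 2 = N%:R * P ^+ 2.
    by rewrite DE /delta; field; rewrite gt_eqF.
  have P2 : 1 <= P ^+ 2 by rewrite expr2; nra.
  by nra.
pose K := (Num.truncn (q * L / ln r)).+1.
have qL0 : 0 <= q * L / ln r by rewrite divr_ge0 ?mulr_ge0 // ltW.
have /andP[K1 K2] := Num.Theory.truncn_itv qL0; rewrite -/K in K2.
have KL : K%:R <= kap * L.
  have -> : kap * L = q * L / ln r + L by rewrite /kap; field; rewrite gt_eqF.
  by rewrite /K -natr1; lra.
have K0 : (0 < K)%N by [].
have K1R : 1 <= K%:R :> R by rewrite ler1n.
pose Q := r ^+ K.
have Qe : expR (q * L) <= Q.
  have r0 : 0 < r by lra.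
  rewrite /Q -[r]lnK // -expRM_natl ler_expR.
  by move: K2; rewrite ltr_pdivrMr // => /ltW.
have expn (n : nat) : expR (n%:R * L) = N%:R ^+ n by rewrite expRM_natl expL.
have QE : expR (4 / Ups * L) * N%:R ^+ 5 <= Q.
  apply: le_trans Qe.
  have -> : q * L = 4 / Ups * L + 5%:R * L by rewrite /q; ring.
  by rewrite expRD expn.
have e1 : 1 <= expR (4 / Ups * L).
  by have := expR_ge1Dx (4 / Ups * L); nra.
have N5 : 4 * N%:R ^+ 3 <= N%:R ^+ 5 :> R.
  rewrite -[5%N]/(2 + 3)%N exprD ler_wpM2r ?exprn_ge0 // expr2; nra.
have N3 : 1 <= N%:R ^+ 3 :> R by rewrite exprn_ege1 //; lra.
have QD : 4 * D%:R <= Q.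
  rewrite DE (le_trans N5) // (le_trans _ QE) // ler_peMl // exprn_ge0 //.
have QU : 8 * D%:R <= (Q / 2) `^ Ups.
  apply: (@le_trans _ _ (expR (4 / Ups * L) `^ Ups)).
    rewrite -expRM; have -> : 4 / Ups * L * Ups = 4%:R * L.
      by field; rewrite gt_eqF.
    rewrite expn DE (exprS _ 3) ler_wpM2r ?exprn_ge0 //; lra.
  have hQ : expR (4 / Ups * L) <= Q / 2.
    rewrite ler_pdivlMr // (le_trans _ QE) // ler_wpM2l ?expR_ge0 //; lra.
  have he := expR_ge0 (4 / Ups * L).
  by apply: ge0_ler_powR => //; rewrite ?nnegrE ?(ltW Ups_gt0) //; lra.
pose b i : R := (a (1 + i * K)%N)%:R.
have b0 : 1 <= b 0 by rewrite /b mul0n addn0 ler1n a_pos.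
have r0 : 0 <= r by lra.
have bQ i : Q * b i <= b i.+1.
  rewrite /b mulSn [(K + _)%N]addnC addnA.
  exact: lacunary_iter.
(* The largest [M] for which the last index 1 + M K does not exceed [N]. *)
pose M := (N.-1 %/ K)%N.
have [S [mS muS hS]] := @gap_measure R mu H Ups H_ge0 (ltW Ups_gt0) cos_decay
   D delta Q b M (introT andP (conj d0 d1)) Dd QD QU b0 bQ.
exists S; split=> //; last first.
  move=> x x01 /max_gap_gt[|t [t01 ht]].
    by rewrite divr_ge0 ?powR_ge0.
  apply: hS => //; exists t; split=> // i iM n; apply: ht.
  apply/mapP; exists (1 + i.+1 * K)%N => //.
  rewrite mem_iota leq_addr /= add1n ltnS.
  have : (i.+1 * K <= M * K)%N by rewrite leq_mul2r iM orbT.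
  move=> h; rewrite -(prednK N0) ltnS.
  exact: leq_trans h (leq_trunc_div _ _).
apply: (le_trans muS); rewrite lee_fin.
set W := _ + H.
have W0 : 0 <= W by rewrite addr_ge0 // fine_ge0.
have MK : N%:R <= (M%:R + 1) * K%:R :> R.
  by rewrite natr1 -natrM ler_nat -{1}(prednK N0) ltn_ceil.
have NK : 2 * K%:R <= N%:R :> R.
  have kL : kap * L <= kap * L ^+ 2 by rewrite ler_wpM2l //; lra.
  have kL0 : 0 <= kap * L by rewrite mulr_ge0 ?(ltW L0) // (le_trans ler01).
  by move: PV; rewrite /V; lra.
(* The resulting factor N^-6 beats the D = N^3 positions and leaves N^-3. *)
have dM : 6 * L <= delta * M%:R / 8.
  have MK2 : N%:R / 2 <= M%:R * K%:R :> R by lra.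
  have h1 : L * V / 2 <= delta * M%:R * kap.
    have h2 : L ^+ 2 * V / 2 <= delta * M%:R * (kap * L).
      apply: (@le_trans _ _ (delta * (M%:R * K%:R))); last first.
        by rewrite mulrA ler_wpM2l // mulr_ge0 // ltW.
      apply: (@le_trans _ _ (delta * (N%:R / 2))); last by rewrite ler_wpM2l // ltW.
      have -> : delta * (N%:R / 2) = P / 2 by rewrite /delta; field; rewrite gt_eqF.
      by lra.
    by rewrite -(ler_pM2r L0); nra.
  rewrite /V in h1.
  by rewrite -(@ler_pM2r _ kap); lra.
have eN : expR (- (delta * M%:R / 8)) <= (N%:R ^+ 6)^-1.
  by rewrite -expn -expRN ler_expR lerN2.
apply: (@le_trans _ _ (3 * D%:R * ((N%:R ^+ 6)^-1 * W))).
  by rewrite ler_wpM2l ?mulr_ge0 // ler_wpM2r.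
have -> : 3 * D%:R * ((N%:R ^+ 6)^-1 * W) = 3 * W / N%:R ^+ 3.
  by rewrite DE; field; rewrite gt_eqF.
have N1 : 0 < N%:R + 1 :> R by lra.
rewrite ler_wpM2l ?mulr_ge0 // lef_pV2 ?posrE ?exprn_gt0 ?mulr_gt0 //.
by rewrite exprS ler_wpM2l // expr2; nra.
Qed.

(** The majorant telescopes, so the first n terms sum to at most V (1 - 1/(n+1)). *)
Lemma sum_inv_consecutive_lty (V : R) (u : nat -> \bar R) : 0 <= V ->
  (forall n, 0 <= u n)%E ->
  (forall n, (u n <= (V / (n.+1%:R * (n.+1%:R + 1)))%:E)%E) ->
  (\sum_(n <oo) u n < +oo)%E.
Proof.
move=> V0 u0 uV.
apply: (@le_lt_trans _ _ V%:E); last by rewrite ltry.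
apply: lime_le; first by apply: is_cvg_nneseries => n _ _.
apply: nearW => n.
apply: (@le_trans _ _ (V * (1 - (n.+1%:R)^-1))%:E); last first.
  by rewrite lee_fin ler_piMr // gerBl invr_ge0.
elim: n => [|n IH]; first by rewrite big_nil invr1 subrr mulr0.
rewrite big_nat_recr //= (le_trans (leeD IH (uV n))) // -EFinD lee_fin.
rewrite -[n.+2%:R]natr1 le_eqVlt; apply/orP; left; apply/eqP.
have n1 : 0 < n.+1%:R :> R by rewrite ltr0n.
by field; rewrite !gt_eqF //; lra.
Qed.

End LargeGaps.

Theorem theorem2p4 (R : realType) (eps r : R) (a : nat -> nat)
    (mu : {finite_measure set (measurableTypeR R) -> \bar R})
    (eps_gt0 : 0 < eps)
    (r_gt1 : 1 < r)
    (a_increasing : increasing_seq1 a)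
    (a_pos : positive_seq1 a)
    (a_lacunary : lacunary1 r (fun n : nat => (a n)%:R))
    (mu_supp : supported_in_01 mu)
    (mu_decay : exists Upsilon C : R, [/\ 0 < Upsilon, 0 < C &
       forall x : R,
         `|fourier mu x| <= ((C * (1 + `|x|) `^ (- Upsilon))%:C)%C]) :
  {ae mu, forall alpha : R, alpha \in `[0, 1] ->
     exists N0 : nat, forall N : nat, (0 < N)%N -> (N0 <= N)%N ->
       max_gap [seq alpha * (a n)%:R | n <- iota 1 N]
         <= (ln N%:R) `^ (2 + eps) / N%:R}.
Proof.
have [Ups [C [Ups0 C0 decay]]] := mu_decay.
have H0 : 0 <= 2 * C by lra.
have cos_decay w t :
    `|Rintegral mu `[0, 1] (fun x => cos (2 * pi * w * x + t))| <=
      2 * C * (1 + `|w|) `^ (- Ups).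
  rewrite -[leRHS]mulrA.
  exact: (cos_decay_of_fourier mu (fun x => C * (1 + `|x|) `^ (- Ups)) decay w t).
have [T hT] := large_gap_measure _ _ _ H0 Ups0 cos_decay _ _ _
  eps_gt0 r_gt1 a_pos a_lacunary.
pose N1 := (Num.truncn (expR T)).+1.
have lnT N : (N1 <= N)%N -> T <= ln N%:R.
  move=> NN1; rewrite -[T]expRK ler_ln ?posrE ?expR_gt0 ?ltr0n //.
    have /andP[_ h] := Num.Theory.truncn_itv (expR_ge0 T).
    by rewrite (le_trans (ltW h)) // ler_nat.
  exact: leq_trans NN1.
(* Shifting by [N1] puts every N = n + N1 beyond the threshold, so [F n] controls the gap for that
   N. *)
have [F hF] := choice (fun n : nat =>
  hT (n + N1)%N (ltn_addl n (ltn0Sn _)) (lnT _ (leq_addl n N1))).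
have W0 : 0 <= 3 * (fine (mu `[0%R, 1%R]%classic) + 2 * C).
  by rewrite mulr_ge0 // addr_ge0 // fine_ge0.
exists (lim_sup_set F); split.
- by apply: bigcap_measurable => // k _; apply: bigcup_measurable => n _; case: (hF n).
- apply: lim_sup_set_cvg0 => [k|]; first by case: (hF k).
  apply: (sum_inv_consecutive_lty _ _ W0) => n; first exact: measure_ge0.
  have [_ h _] := hF n; apply: (le_trans h); rewrite lee_fin ler_wpM2l //.
  have nN : n.+1%:R <= (n + N1)%:R :> R by rewrite ler_nat addnS ltnS leq_addr.
  have n1 : 0 < n.+1%:R :> R by rewrite ltr0n.
  by rewrite lef_pV2 ?posrE ?mulr_gt0 //; nra.
(* If [x] avoids every [F j] with j >= n for some [n], then n + N1 serves as [N0]. *)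
- move=> x /= nx n _; apply: contrapT => hn; apply: nx => x01.
  exists (n + N1)%N => N N0 nN; rewrite leNgt; apply/negP => gap.
  apply: hn; exists (N - N1)%N.
    by rewrite /= leq_subRL ?(leq_trans (leq_addl n N1)) // addnC.
  have [_ _ h] := hF (N - N1)%N.
  apply: h; first by move: x01; rewrite in_itv.
  by rewrite subnK // (leq_trans (leq_addl n N1)).
Qed.
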